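(* The following lower bounds hold. (1) For every integer $\ell$ with $1\leqslant \ell\leqslant 10$, there is a regular $2$-dimensional train network with trains of length $\ell$, all of whose lines are positive, such that every (collision-free) schedule for it has delay at least $2\ell-1$. (2) There is a regular $2$-dimensional train network with trains of length $1$ (lines of unrestricted sign) such that every schedule for it has delay at least $1$. (3) There is a regular $2$-dimensional train network with trains of length $2$ (lines of unrestricted sign) such that every schedule for it has delay at least $7$. (4) There is a regular $3$-dimensional train network with trains of length $1$, all of whose lines are positive, such that every schedule for it has delay at least $2$.
   Context: A ($d$-dimensional) train line consists of: a track, which is a line segment in $\mathbb{R}^d$ with distinct endpoints, one designated the departure point and the other the arrival point; a train length, which is a positive real number; and a speed, which is a positive real number. A train network is a set of train lines whose tracks are pairwise non-overlapping (but possibly crossing). Here two tracks overlap if their intersection contains a non-degenerate segment, and two tracks cross if they are not parallel and have a common point, called their crossing point. For a set $X$ of real numbers and a real number $y$, $X+y=\{x+y : x\in X\}$. A (collision-free) schedule for a train network assigns to each of its lines a delay, which is a non-negative real number (not necessarily an integer), such that for any two lines whose tracks cross, the open intervals $(0,\ell/v)+t+\delta/v$ and $(0,\ell'/v')+t'+\delta'/v'$ do not intersect, where $t,t'$ are the respective delays assigned to the two lines, $\delta,\delta'$ are the respective distances from their departure points to the crossing point, $\ell,\ell'$ are their respective train lengths and $v,v'$ their respective speeds. The delay of a schedule is the maximum delay it assigns (read as a supremum in $[0,\infty]$ if the network is infinite or empty). A $d$-dimensional train network is regular if all its lines have speed $1$, all its lines have the same train length and it is an integer, all its tracks are axis-parallel,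 and all its departure and arrival points are in $\mathbb{Z}^d$. A line with axis-parallel track departing from $p\in\mathbb{R}^d$ and arriving at $p+\alpha e_i$, where $e_i$ ($0\leqslant i<d$) is a vector of the canonical basis of $\mathbb{R}^d$ and $\alpha\neq 0$, is positive if $\alpha>0$ and negative if $\alpha<0$. *)

(* Defs.v *)
From HB Require Import structures.
From mathcomp Require Import all_boot all_order all_algebra.
From mathcomp Require Import all_classical all_reals ereal.

Set Implicit Arguments.
Unset Strict Implicit.
Unset Printing Implicit Defensive.

Import Order.TTheory GRing.Theory Num.Theory.

Local Open Scope classical_set_scope.
Local Open Scope ring_scope.

Section TrainNetworks.
Variables (R : realType) (d : nat).

Definition segment (a b : 'rV[R]_d) : set 'rV[R]_d :=
  [set (1 - s) *: a + s *: b | s in [set s : R | 0 <= s <= 1]].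

(* The norm that MathComp-Analysis puts on row vectors is the sup norm, so the
   Euclidean distance is spelled out. *)
Definition edist (x y : 'rV[R]_d) : R :=
  Num.sqrt (\sum_(i < d) (x 0 i - y 0 i) ^+ 2).

Record train_line := TrainLine {
  departure : 'rV[R]_d;
  arrival : 'rV[R]_d;
  train_length : R;
  speed : R;
  departure_neq_arrival : departure != arrival;
  train_length_gt0 : 0 < train_length;
  speed_gt0 : 0 < speed
}.

Definition track (L : train_line) : set 'rV[R]_d :=
  segment (departure L) (arrival L).

Definition overlap (L L' : train_line) : Prop :=
  exists a b : 'rV[R]_d, a != b /\ segment a b `<=` track L `&` track L'.

(* Both direction vectors are nonzero, so this relation is symmetric. *)
Definition parallel (L L' : train_line) : Prop :=
  exists c : R, arrival L' - departure L' = c *: (arrival L - departure L).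

Definition cross_at (L L' : train_line) (p : 'rV[R]_d) : Prop :=
  ~ parallel L L' /\ (track L `&` track L') p.

Record train_network := TrainNetwork {
  lines : set train_line;
  lines_nonoverlapping :
    forall L L', lines L -> lines L' -> L <> L' -> ~ overlap L L'
}.

Definition translate (X : set R) (y : R) : set R := [set x + y | x in X].

Definition occupation (L : train_line) (t : R) (p : 'rV[R]_d) : set R :=
  translate
    (translate [set x : R | 0 < x < train_length L / speed L] t)
    (edist (departure L) p / speed L).

(* The values of t outside N are irrelevant, here and in delay. *)
Definition schedule (N : train_network) (t : train_line -> R) : Prop :=
  (forall L, lines N L -> 0 <= t L) /\
  (forall L L' p, lines N L -> lines N L' -> cross_at L L' p ->
     occupation L (t L) p `&` occupation L' (t L') p = set0).

(* Supremum in [0, +oo]: adding 0 only matters when N is empty. *)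
Definition delay (N : train_network) (t : train_line -> R) : \bar R :=
  ereal_sup (0%:E |` [set (t L)%:E | L in lines N]).

Definition directed_along (L : train_line) (i : 'I_d) (alpha : R) : Prop :=
  arrival L = departure L + alpha *: delta_mx 0 i.

Definition axis_parallel (L : train_line) : Prop :=
  exists (i : 'I_d) (alpha : R), alpha != 0 /\ directed_along L i alpha.

Definition positive_line (L : train_line) : Prop :=
  exists (i : 'I_d) (alpha : R), 0 < alpha /\ directed_along L i alpha.

Definition integer_point (p : 'rV[R]_d) : Prop :=
  forall i, p 0 i \is a Num.int.

Definition has_length (N : train_network) (l : int) : Prop :=
  forall L, lines N L -> train_length L = l%:~R.

Definition regular (N : train_network) : Prop :=
  [/\ forall L, lines N L -> speed L = 1,
      exists l : int, has_length N l,
      forall L, lines N L -> axis_parallel L &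
      forall L, lines N L -> integer_point (departure L) /\ integer_point (arrival L)].

Definition all_positive (N : train_network) : Prop :=
  forall L, lines N L -> positive_line L.

Definition delay_at_least (N : train_network) (m : int) : Prop :=
  forall t, schedule N t -> ((m%:~R : R)%:E <= delay N t)%E.

End TrainNetworks.

(* Main.v *)
(* (1) On the l x l grid whose i-th row starts at (-2i, i) and whose i-th column
   starts at (i, -2i), a delay t of line i amounts to the number t + i, and the
   trains on a row and a column avoid each other iff their numbers differ by at
   least l.  If all delays are below 2l - 1, the numbers of the rows cannot jump
   over that of column 0, nor those of the columns over that of row 0, although
   the last numbers are at least l - 1.
   (2) is the case l = 1 of (1).
   (3) On the square [0, 11]^2, let the rows and columns at positions 0, ..., 5
   run forward and those at 6, ..., 11 backward.  Rounding delays down preserves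
   schedules, so delays below 7 may be taken in {0, ..., 6}; these finitely many
   assignments are excluded by backtracking with forward checking.
   (4) Three lines through a common point at distance 1 from their departures. *)
Require Import Defs.
From mathcomp Require Import all_boot all_order all_algebra.
From mathcomp Require Import all_classical all_reals ereal.
From mathcomp Require Import lra zify.
Import Order.TTheory GRing.Theory Num.Theory.
Local Open Scope ring_scope.

Set Implicit Arguments.
Unset Strict Implicit.
Unset Printing Implicit Defensive.

(** * Lattice lines: tracks, crossings and occupied times *)

Section LatticeLines.
Variables (R : realType) (d : nat) (l : int) (l_gt0 : 0 < l).

Definition lattice_point (q : 'rV[int]_d) : 'rV[R]_d := map_mx intr q.

(* A lattice line runs from [origin] over the distance [span.+1]. *)
Record lattice_line := LatticeLine {
  axis : 'I_d; origin : 'rV[int]_d; backward : bool; span : nat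
}.
Implicit Types (g h : lattice_line) (c : 'I_d).

Definition stop g (k : nat) : 'rV[int]_d :=
  origin g + ((-1) ^+ backward g * k%:Z) *: delta_mx 0 (axis g).

Lemma lattice_stop g k :
  lattice_point (stop g k) =
  lattice_point (origin g)
    + ((-1) ^+ backward g * k%:R) *: delta_mx 0 (axis g).
Proof.
apply/rowP => c; rewrite !mxE rmorphD !rmorphM rmorphXn rmorphN1 /=.
by rewrite mulrz_nat.
Qed.

Lemma lattice_line_nondegenerate g :
  lattice_point (origin g) != lattice_point (stop g (span g).+1).
Proof.
apply/eqP => /rowP/(_ (axis g))/eqP.
rewrite lattice_stop !mxE !eqxx /= mulr1 eq_sym -subr_eq0 addrC addrK.
by rewrite mulf_eq0 signr_eq0 pnatr_eq0.
Qed.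

Lemma intr_l_gt0 : 0 < l%:~R :> R. Proof. by rewrite ltr0z. Qed.

Definition train g : train_line R d :=
  TrainLine (lattice_line_nondegenerate g) intr_l_gt0 ltr01.

Lemma track_coord g p c : track (train g) p -> c != axis g ->
  p 0 c = (origin g 0 c)%:~R.
Proof.
case=> s _ <- /negPf cNa.
by rewrite /= lattice_stop !mxE cNa andbF mulr0 addr0 -mulrDl subrK mul1r.
Qed.

Lemma track_stop g k : (k <= (span g).+1)%N ->
  track (train g) (lattice_point (stop g k)).
Proof.
move=> k_le; have sp0 : 0 < (span g).+1%:R :> R by rewrite ltr0n.
exists (k%:R / (span g).+1%:R).
  by rewrite /= divr_ge0 ?ler0n //= ler_pdivrMr // mul1r ler_nat.
rewrite /= !lattice_stop scalerDr addrA -scalerDl subrK scale1r scalerA.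
by congr (_ + _ *: _); rewrite mulrCA divfK // gt_eqF.
Qed.

Lemma edist_stop g k : edist (departure (train g)) (lattice_point (stop g k)) = k%:R.
Proof.
rewrite /edist /= lattice_stop (bigD1 (axis g)) //= big1 => [|c /negPf cNa].
  rewrite !mxE !eqxx /= mulr1 opprD addNKr addr0 sqrrN exprMn sqrr_sign mul1r.
  by rewrite sqrtr_sqr ger0_norm.
by rewrite !mxE cNa andbF mulr0 addr0 subrr expr0n.
Qed.

Lemma train_not_parallel g h : axis g != axis h -> ~ parallel (train g) (train h).
Proof.
move=> /negPf gNh [a] /rowP/(_ (axis h)) /=; rewrite !lattice_stop addrAC subrr.
rewrite add0r [X in a *: X]addrAC subrr add0r !mxE !eqxx eq_sym gNh /= !mulr0 mulr1.
by move/eqP; rewrite mulf_eq0 signr_eq0 pnatr_eq0.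
Qed.

Lemma train_no_overlap g h :
  axis g != axis h \/ (exists2 c, c != axis g & origin g 0 c != origin h 0 c) ->
  ~ overlap (train g) (train h).
Proof.
move=> gh [a [b [aNb sub]]].
have [ag ah] : (track (train g) `&` track (train h))%classic a.
  by apply: sub; exists 0; rewrite /= ?lexx ?ler01 // subr0 scale1r scale0r addr0.
have [bg bh] : (track (train g) `&` track (train h))%classic b.
  by apply: sub; exists 1; rewrite /= ?lexx ?ler01 // subrr scale1r scale0r add0r.
have [ghE|gNh] := eqVneq (axis g) (axis h).
  case: gh => [/eqP//|[c cg /eqP]]; apply; apply/eqP; rewrite -(eqr_int R).
  by rewrite -(track_coord ag cg) -(track_coord ah) // -ghE.
case/eqP: aNb; apply/rowP => c.
have [cg|cg] := eqVneq c (axis g).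
  by rewrite (track_coord ah) ?(track_coord bh) // cg.
by rewrite (track_coord ag) ?(track_coord bg).
Qed.

Lemma occupation_stop g t k :
  occupation (train g) t (lattice_point (stop g k)) =
  [set x | t + k%:R < x < t + k%:R + l%:~R]%classic.
Proof.
rewrite /occupation edist_stop /= !divr1.
apply/seteqP; split=> [x /= [_ [y /andP[y0 yl] <-] <-]|x /= /andP[xt xl]].
  by apply/andP; split; lra.
exists (x - k%:R); last by rewrite subrK.
by exists (x - k%:R - t); [apply/andP; split; lra | rewrite subrK].
Qed.

Section Network.
Variables (J : Type) (f : J -> lattice_line).
Hypothesis f_separated : forall j k, j <> k -> axis (f j) != axis (f k) \/
  (exists2 c, c != axis (f j) & origin (f j) 0 c != origin (f k) 0 c).

Lemma range_nonoverlapping L L' :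
  range (fun j => train (f j)) L -> range (fun j => train (f j)) L' -> L <> L' ->
  ~ overlap L L'.
Proof.
move=> [j _ <-] [k _ <-] jNk; apply/train_no_overlap/f_separated => jk.
by case: jNk; rewrite jk.
Qed.

Definition network : train_network R d := TrainNetwork range_nonoverlapping.

Lemma network_has_length : has_length network l.
Proof. by move=> _ [j _ <-]. Qed.

Lemma network_regular : regular network.
Proof.
split; first by move=> _ [j _ <-].
- by exists l; apply: network_has_length.
- move=> _ [j _ <-]; exists (axis (f j)).
  exists ((-1) ^+ backward (f j) * (span (f j)).+1%:R); split.
    by rewrite mulf_neq0 ?signr_eq0 ?pnatr_eq0.
  by rewrite /directed_along /= lattice_stop.
- by move=> _ [j _ <-]; split=> c; rewrite mxE; apply: intr_int.
Qed.

Lemma network_positive :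
  (forall j, backward (f j) = false) -> all_positive network.
Proof.
move=> fwd _ [j _ <-]; exists (axis (f j)), (span (f j)).+1%:R; split=> //.
by rewrite /directed_along /= lattice_stop fwd mul1r.
Qed.

(** Open intervals of length [l] whose left ends are less than [l] apart meet, so collision-freeness
    becomes inequalities between crossing times. *)
Lemma network_delay_at_least m :
  (forall t : J -> R, (forall j, 0 <= t j < m%:~R) ->
     (forall j k a b, axis (f j) != axis (f k) ->
        (a <= (span (f j)).+1)%N -> (b <= (span (f k)).+1)%N ->
        stop (f j) a = stop (f k) b ->
        l%:~R <= `|(t j + a%:R) - (t k + b%:R)|) -> False) ->
  delay_at_least network m.
Proof.
move=> no_schedule t [t_ge0 t_free]; rewrite leNgt; apply/negP => delay_lt.
apply: (no_schedule (fun j => t (train (f j)))) => [j|j k a b jk a_le b_le ab].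
  rewrite t_ge0 /=; last by exists j.
  rewrite -lte_fin; apply: le_lt_trans delay_lt; apply: ereal_sup_ubound.
  by right; exists (train (f j)) => //; exists j.
set u := _ + a%:R; set v := _ + b%:R.
have cross : cross_at (train (f j)) (train (f k)) (lattice_point (stop (f j) a)).
  split; first exact: train_not_parallel.
  by split; [apply: track_stop | rewrite ab; apply: track_stop].
have := t_free _ _ _ (ex_intro2 _ _ j I erefl) (ex_intro2 _ _ k I erefl) cross.
rewrite occupation_stop ab occupation_stop -/u -/v.
have l0 := intr_l_gt0.
(* The midpoint of the common part of the two intervals. *)
move=> /seteqP[/(_ (Num.max u v + (l%:~R - `|u - v|) / 2))/= disj _].
rewrite leNgt; apply/negP => uv; apply: disj.
by move: uv; case: (lerP u v) => ?; case: (lerP 0 (u - v)) => ? ?;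
  split; apply/andP; split; lra.
Qed.

End Network.
End LatticeLines.

(** * Planar grids of rows and columns *)

Section Grid.
Variables (R : realType) (n : nat) (start : 'I_n -> int) (back : 'I_n -> bool).
(** [lag i j] is the distance from the departure of line [i] to its crossing with the perpendicular
    line [j]. *)
Variables (extent : 'I_n -> nat) (lag : 'I_n -> 'I_n -> nat).

Definition grid_axis (b : bool) : 'I_2 := if b then 1 else 0.

(* Rows are the lines [(false, y)], columns the lines [(true, x)]; they are
   mirror images of each other in the diagonal. *)
Definition grid_line (r : bool * 'I_n) : lattice_line 2 :=
  LatticeLine (grid_axis r.1)
    (\row_c if c == grid_axis r.1 then start r.2 else (r.2 : nat)%:Z)
    (back r.2) (extent r.2).

Lemma grid_axis_eq b b' : (grid_axis b == grid_axis b') = (b == b').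
Proof. by case: b b' => [] []. Qed.

Lemma grid_separated r r' : r <> r' ->
  axis (grid_line r) != axis (grid_line r') \/
  (exists2 c, c != axis (grid_line r)
     & origin (grid_line r) 0 c != origin (grid_line r') 0 c).
Proof.
case: r r' => [b i] [b' i'] /= rr'; rewrite grid_axis_eq.
have [bb'|] := eqVneq b b'; [right | by left].
subst b'; have bN : (~~ b == b) = false by case: b {rr'}.
exists (grid_axis (~~ b)); rewrite ?mxE grid_axis_eq bN //.
by rewrite eqz_nat; apply/eqP => /val_inj ii'; apply: rr'; rewrite ii'.
Qed.

Hypothesis lag_extent : forall i j, (lag i j <= (extent i).+1)%N.
Hypothesis lagP : forall i j, start i + (-1) ^+ back i * (lag i j)%:Z = (j : nat)%:Z.

Lemma grid_crossing (i j : 'I_n) :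
  stop (grid_line (false, i)) (lag i j) = stop (grid_line (true, j)) (lag j i).
Proof.
apply/rowP => -[[|[|//]] c_lt]; rewrite !mxE /= ?mulr1 ?mulr0 ?addr0 lagP //.
Qed.

Lemma grid_network (l m : int) : 0 < l ->
  (forall t : bool -> 'I_n -> R, (forall b i, 0 <= t b i < m%:~R) ->
     (forall i j, l%:~R <=
        `|(t false i + (lag i j)%:R) - (t true j + (lag j i)%:R)|) -> False) ->
  exists N : train_network R 2,
    [/\ regular N, has_length N l, (forall i, back i = false) -> all_positive N &
        delay_at_least N m].
Proof.
move=> l_gt0 no_schedule; exists (network R l_gt0 grid_separated); split.
- exact: network_regular.
- exact: network_has_length.
- by move=> fwd; apply: network_positive => -[].
- apply: network_delay_at_least => t t_bounds t_free.
  apply: (no_schedule (fun b i => t (b, i))) => // i j.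
  by apply: t_free => //; apply: grid_crossing.
Qed.

End Grid.

(* If [T 0] lies below [S 0], then so does every [T i], since the step from
   [T i] to [T i.+1] is too short to jump over the forbidden interval of length
   [2 l] around [S 0]; but [T l.-1] is at least [l - 1]. *)
Lemma staircase_below (R : realType) (l : nat) (T S : nat -> R) : (0 < l)%N ->
  (forall i, (i < l)%N -> 0 <= T i - i%:R < (2 * l)%:R - 1) ->
  (forall i, (i < l)%N -> 0 <= S i - i%:R < (2 * l)%:R - 1) ->
  (forall i j, (i < l)%N -> (j < l)%N -> l%:R <= `|T i - S j|) ->
  S 0%N <= T 0%N.
Proof.
rewrite natrM => l_gt0 T_bounds S_bounds TS; rewrite leNgt; apply/negP => TS0.
have below i : (i < l)%N -> T i < S 0%N.
  elim: i => [//|i IHi] il; have := IHi (ltnW il).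
  have := TS _ _ (ltnW il) l_gt0; have := TS _ _ il l_gt0.
  have := T_bounds _ il; have := T_bounds _ (ltnW il); rewrite -natr1.
  by rewrite !ler_normr => /andP[? ?] /andP[? ?] /orP[] ? /orP[] ? ?; lra.
case: l l_gt0 T_bounds S_bounds TS below => // l _ T_bounds S_bounds TS below.
(* [T l] is at least [l] and lies at least [l.+1] below [S 0], so [S 0] reaches its excluded upper
   bound. *)
have := T_bounds _ (ltnSn l); have := S_bounds _ (ltn0Sn l).
have := TS _ _ (ltnSn l) (ltn0Sn l); have := below _ (ltnSn l).
by rewrite ler_normr -natr1 => ? /orP[] ? /andP[? ?] /andP[? ?]; lra.
Qed.

(** The comparison applies both ways, so [T 0 = S 0], against their distance of at least [l]. *)
Lemma staircase_contradiction (R : realType) (l : nat) (T S : nat -> R) : (0 < l)%N ->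
  (forall i, (i < l)%N -> 0 <= T i - i%:R < (2 * l)%:R - 1) ->
  (forall i, (i < l)%N -> 0 <= S i - i%:R < (2 * l)%:R - 1) ->
  ~ (forall i j, (i < l)%N -> (j < l)%N -> l%:R <= `|T i - S j|).
Proof.
move=> l_gt0 T_bounds S_bounds TS; have := TS _ _ l_gt0 l_gt0.
rewrite (@le_anti _ _ (T 0%N) (S 0%N)); last first.
  apply/andP; split; last exact: staircase_below TS.
  by apply: (@staircase_below _ l) => // i j il jl; rewrite distrC; apply: TS.
by rewrite subrr normr0 lern0 gtn_eqF.
Qed.

Lemma positive_network (R : realType) (l : nat) : (0 < l)%N ->
  exists N : train_network R 2,
    [/\ regular N, has_length N l, all_positive N & delay_at_least N (2 * l%:Z - 1)].
Proof.
move=> l_gt0.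
have [i j|i j|||N [? ? Npos ?]] := @grid_network R l (fun i => - (i + i)%:Z)
  (fun=> false) (fun i => (l + (i + i))%N) (fun i j => (i + i + j)%N) _ _
  l (2 * l%:Z - 1).
- by have := ltn_ord j; lia.
- by rewrite mul1r (PoszD (i + i)%N) addKr.
- by [].
- move=> t t_bounds t_free.
  (* The default 0 occurs only for [i >= l], outside the range of the staircase bounds. *)
  pose T b i : R := oapp (t b) 0 (insub i) + i%:R.
  have T_ord b (i : 'I_l) : T b i = t b i + i%:R by rewrite /T valK.
  apply: (@staircase_contradiction R l (T false) (T true)) => // [i il|i il|i j il jl].
  + rewrite -[i]/(val (Ordinal il)) T_ord addrK.
    by have := t_bounds false (Ordinal il); rewrite intrB intrM natrM.
  + rewrite -[i]/(val (Ordinal il)) T_ord addrK.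
    by have := t_bounds true (Ordinal il); rewrite intrB intrM natrM.
  + rewrite -[i]/(val (Ordinal il)) -[j]/(val (Ordinal jl)) !T_ord.
    have := t_free (Ordinal il) (Ordinal jl); rewrite /= !natrD.
    (* The row has lag [2 i + j] and the column [2 j + i]; the common [i + j] cancels. *)
    rewrite (_ : t _ _ + _ - (t _ _ + _) =
      t false (Ordinal il) + i%:R - (t true (Ordinal jl) + j%:R)) //; lra.
- by exists N; split=> //; apply: Npos.
Qed.

(** * Lines through a common point *)

Section Concurrent.
Variables (R : realType) (d : nat).

Definition central_line (i : 'I_d) : lattice_line d :=
  LatticeLine i (- delta_mx 0 i) false 1.

Lemma central_separated i j : i <> j ->
  axis (central_line i) != axis (central_line j) \/
  (exists2 c, c != axis (central_line i)
     & origin (central_line i) 0 c != origin (central_line j) 0 c).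
Proof. by left; apply/eqP. Qed.

Lemma stop_central i : stop (central_line i) 1 = 0.
Proof. by rewrite /stop mul1r scale1r addNr. Qed.

End Concurrent.

Lemma concurrent_network (R : realType) :
  exists N : train_network R 3,
    [/\ regular N, has_length N 1, all_positive N & delay_at_least N 2].
Proof.
exists (network R ltr01 (@central_separated 3)); split.
- exact: network_regular.
- exact: network_has_length.
- exact: network_positive.
apply: network_delay_at_least => t t_bounds t_free.
have apart i j : i != j -> 1 <= `|t i - t j|.
  move=> ij; have := t_free i j 1%N 1%N ij isT isT.
  by rewrite !stop_central opprD addrACA subrr addr0 => /(_ erefl).
(* Of three numbers pairwise at least 1 apart, two differ by at least 2, which [[0, 2)] forbids. *)
have := apart 0 1 isT; have := apart 0 2 isT; have := apart 1 2 isT.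
have /andP[? ?] := t_bounds 0; have /andP[? ?] := t_bounds 1.
have /andP[? ?] := t_bounds 2.
by rewrite !ler_normr => /orP[] ? /orP[] ? /orP[] ?; lra.
Qed.

(** * Exhaustive search and the square network *)

Section Refute.
Variables (T : eqType) (compat : T -> nat -> T -> nat -> bool).
Implicit Types (st : seq (T * seq nat)).

Definition restrict x u st : seq (T * seq nat) :=
  [seq (p.1, [seq v <- p.2 | compat x u p.1 v]) | p <- st].

(* [n] bounds the search depth. *)
Fixpoint refute n st : bool :=
  if n is n'.+1 then
    if sort (fun p q => size p.2 <= size q.2)%N st is (x, D) :: st' then
      all (fun u => refute n' (restrict x u st')) D
    else false
  else false.

(** On the branch that gives [x] the value [t x], the solution [t] survives the restriction of the
    domains, so this branch never closes. *)
Lemma refute_sound (t : T -> nat) n st :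
  {in map fst st &, forall x y, compat x (t x) y (t y)} ->
  {in st, forall p, t p.1 \in p.2} -> ~~ refute n st.
Proof.
elim: n st => //= n IHn st compat_t dom_t.
have mem_st p : (p \in sort (fun p q => size p.2 <= size q.2)%N st) = (p \in st).
  by rewrite mem_sort.
case: (sort _ _) mem_st => [//|[x D] st'] mem_st.
have st'P p : p \in st' -> p \in st by move=> pst; rewrite -mem_st in_cons pst orbT.
have xst : (x, D) \in st by rewrite -mem_st mem_head.
apply/allPn; exists (t x); first exact: dom_t xst.
apply: IHn => [y z|_ /mapP[p /st'P pst ->]] /=.
  rewrite -map_comp => /mapP[p /st'P pst ->] /mapP[q /st'P qst ->] /=.
  by apply: compat_t; apply: map_f.
rewrite mem_filter dom_t // andbT.
by apply: compat_t; [apply: (map_f fst xst) | apply: map_f].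
Qed.

End Refute.

(* Distance from the departure of the line at position [i] of the square to its
   crossing with the perpendicular line at position [j]. *)
Definition square_lag (i j : nat) : nat := if (i < 6)%N then j else (11 - j)%N.

(** The crossing condition for trains of length 2, split in two to avoid truncated subtraction;
    lines of the same direction never cross. *)
Definition square_compat (x : bool * nat) (u : nat) (y : bool * nat) (v : nat) : bool :=
  [|| x.1 == y.1, u + square_lag x.2 y.2 + 2 <= v + square_lag y.2 x.2
    | v + square_lag y.2 x.2 + 2 <= u + square_lag x.2 y.2]%N.

Definition square_domains : seq ((bool * nat) * seq nat) :=
  [seq ((b, i), iota 0 7) | b <- [:: true; false], i <- iota 0 12].

(** Each level of the search fixes one of the 24 lines, so depth 24 suffices. *)
Lemma square_refuted : refute square_compat 24 square_domains.
Proof. by vm_compute. Qed.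

Lemma square_network (R : realType) :
  exists N : train_network R 2, [/\ regular N, has_length N 2 & delay_at_least N 7].
Proof.
have [i j|i j|//||N [? ? _ ?]] := @grid_network R 12
  (fun i => if (i < 6)%N then 0 else 11) (fun i => (6 <= i)%N)
  (* Span 10 encodes the distance 11, the side of the square. *)
  (fun=> 10%N) (fun i j => square_lag i j) _ _ 2 7; last by exists N.
- by rewrite /square_lag; have := ltn_ord j; case: ifP; lia.
- rewrite /square_lag (leqNgt 6); have := ltn_ord j.
  by case: (i < 6)%N; rewrite ?expr0 ?expr1; lia.
move=> t t_bounds t_free.
pose t' (x : bool * nat) := Num.truncn (t x.1 (inord x.2)).
have t'P b i : (t' (b, i))%:R <= t b (inord i) < (t' (b, i))%:R + 1.
  by rewrite natr1 truncn_itv //; case/andP: (t_bounds b (inord i)).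
apply/negP: square_refuted; apply: (@refute_sound _ _ t').
  move=> _ _ /mapP[_ /allpairsP[[b i] [_ + ->]] ->]
    /mapP[_ /allpairsP[[c j] [_ + ->]] ->] /=.
  rewrite !mem_iota /= => i12 j12; rewrite /square_compat /=.
  (* Compatibility is symmetric and trivial between lines of the same direction. *)
  wlog [-> ->]: b c i j i12 j12 / b = false /\ c = true.
    move=> IH; case: b c => [] [] //; last exact: IH.
    by have := IH false true j i j12 i12 (conj erefl erefl); rewrite /= orbC.
  have := t_free (inord i) (inord j); rewrite !inordK //= ler_normr.
  have /andP[t1 t2] := t'P false i; have /andP[s1 s2] := t'P true j.
  (* Rounding loses less than 1, so the inequality holds strictly with 1 to spare, hence exactly
     between integers. *)
  by move=> ts; apply/orP; case/orP: ts => ts; [right | left];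
    rewrite -ltnS -(ltr_nat R) -natr1 !natrD; lra.
move=> _ /allpairsP[[b i] [_ _ ->]]; rewrite [_ \in _]mem_iota /= add0n -(ltr_nat R).
have /andP[t1 _] := t'P b i; apply: le_lt_trans t1 _.
by case/andP: (t_bounds b (inord i)).
Qed.

Theorem mainTheorem3 (R : realType) :
  (forall l : int, 1 <= l <= 10 ->
     exists N : train_network R 2,
       [/\ regular N, has_length N l, all_positive N &
           delay_at_least N (2 * l - 1)]) /\
  (exists N : train_network R 2,
     [/\ regular N, has_length N 1 & delay_at_least N 1]) /\
  (exists N : train_network R 2,
     [/\ regular N, has_length N 2 & delay_at_least N 7]) /\
  (exists N : train_network R 3,
     [/\ regular N, has_length N 1, all_positive N & delay_at_least N 2]).
Proof.
split; last split; last split.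
- by case=> // l /andP[l_gt0 _]; apply: positive_network.
- by have [N [? ? _ ?]] := @positive_network R 1 isT; exists N.
- exact: square_network.
- exact: concurrent_network.
Qed.
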